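(* Let $f:\mathbb{R}^n\to\mathbb{R}$, $\mathbb{D}\subset\mathbb{R}^n$, $\mathbb{K}\subset\mathbb{R}^m$, $H\in\mathbb{R}^{m\times n}$, $g\in\mathbb{R}^m$ satisfy Assumption A (see context) with $\mu=0$ and some $\lambda\geq 0$, and let $(z^\star,w^\star)\in\mathbb{D}\times\mathbb{K}^\circ$ be a saddle point as in item 3 of Assumption A. Let $\beta>0$ and $\sigma\geq |||H|||^2$ with $\beta\sigma+\lambda>0$, and set $\alpha:=\frac{1}{\beta\sigma+\lambda}$. Let $k\geq 1$ be an integer, let $z^1\in\mathbb{D}$ and $v^1\in\mathbb{K}^\circ$, and let $z^{j},v^{j},w^{j}$ ($2\leq j\leq k+1$) be generated by the PIPG iteration (see context) with $\alpha^j=\alpha$ and $\beta^j=\beta$ for all $j=1,\ldots,k$. Let $$\tilde z^k:=\frac1k\sum_{j=1}^k z^j,\qquad \overline z^k:=\frac1k\sum_{j=1}^k z^{j+1},\qquad \overline w^k:=\frac1k\sum_{j=1}^k w^{j+1},$$ and $V^1(z,w):=\frac{1}{2\alpha}\|z^1-z\|^2+\frac{1}{2\beta}\|v^1-w\|^2$ for $z\in\mathbb{D}$, $w\in\mathbb{K}^\circ$. Then $\tilde z^k,\overline z^k\in\mathbb{D}$, $\overline w^k\in\mathbb{K}^\circ$, $$d_{\mathbb{K}}(H\tilde z^k-g)\leq \frac{V^1(z^\star,w^\star)}{\beta k},$$ and $$L(\overline z^k,w)-L(z,\overline w^k)\leq \frac{V^1(z,w)}{k}\qquad\text{for all } z\in\mathbb{D},\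 w\in\mathbb{K}^\circ.$$
   Context: Notation. $\langle\cdot,\cdot\rangle$ and $\|\cdot\|$ are the Euclidean inner product and norm; $|||H|||$ is the largest singular value of $H$; $\pi_{\mathbb{S}}[\cdot]$ is the Euclidean projection onto a nonempty closed convex set $\mathbb{S}$. A closed convex cone $\mathbb{K}\subset\mathbb{R}^m$ is a (nonempty) closed convex set with $\gamma w\in\mathbb{K}$ for all $w\in\mathbb{K}$, $\gamma\geq 0$. Its polar cone is $\mathbb{K}^\circ:=\{w\in\mathbb{R}^m : \langle w,y\rangle\leq 0\ \forall y\in\mathbb{K}\}$. The quadratic distance function is $d_{\mathbb{K}}(w):=\min_{v\in\mathbb{K}}\frac12\|w-v\|^2$ (note the square and factor $\frac12$). The Lagrangian is $L(z,w):=f(z)+\langle Hz-g,w\rangle$. The Bregman divergence of a continuously differentiable $f$ is $B_f(z,z'):=f(z)-f(z')-\langle\nabla f(z'),z-z'\rangle$. The underlying problem is: minimize $f(z)$ subject to $Hz-g\in\mathbb{K}$, $z\in\mathbb{D}$. Assumption A (with constants $0\leq\mu\leq\lambda$): 1. $f:\mathbb{R}^n\to\mathbb{R}$ is continuously differentiable and $\frac{\mu}{2}\|z-z'\|^2\leq B_f(z,z')\leq\frac{\lambda}{2}\|z-z'\|^2$ for all $z,z'\in\mathbb{R}^n$. 2. $\mathbb{D}\subset\mathbb{R}^n$ is a closed convex set and $\mathbb{K}\subset\mathbb{R}^m$ is a closed convex cone. 3. There exist $z^\star\in\mathbb{D}$, $w^\star\in\mathbb{K}^\circ$ such that $L(z^\star,\overline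 w)\leq L(z^\star,w^\star)\leq L(\overline z,w^\star)$ for all $\overline z\in\mathbb{D}$, $\overline w\in\mathbb{K}^\circ$. PIPG iteration. Given positive step sizes $\alpha^j,\beta^j$ and $z^1\in\mathbb{D}$, $v^1\in\mathbb{K}^\circ$, for $j=1,2,\ldots$: $$w^{j+1}=\pi_{\mathbb{K}^\circ}[v^j+\beta^j(Hz^j-g)],$$ $$z^{j+1}=\pi_{\mathbb{D}}[z^j-\alpha^j(\nabla f(z^j)+H^\top w^{j+1})],$$ $$v^{j+1}=w^{j+1}+\beta^jH(z^{j+1}-z^j).$$ Superscripts on iterates and step sizes are indices, not powers. *)

(* Defs.v *)
From HB Require Import structures.
From mathcomp Require Import all_boot all_order all_algebra.
From mathcomp Require Import all_classical all_reals all_analysis.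

Set Implicit Arguments.
Unset Strict Implicit.
Unset Printing Implicit Defensive.

Import Order.TTheory GRing.Theory Num.Theory.
Import numFieldNormedType.Exports.

Local Open Scope classical_set_scope.
Local Open Scope ring_scope.

(* The norm `|x| that the library puts on matrices is the sup norm, hence the
   separate Euclidean norm; both induce the same topology, so closedness,
   continuity and differentiability are the library's. *)
Definition dot (R : realType) (n : nat) (x y : 'cV[R]_n) : R :=
  \sum_(i < n) x i 0 * y i 0.

Definition enorm (R : realType) (n : nat) (x : 'cV[R]_n) : R :=
  Num.sqrt (dot x x).

(* H^T H is symmetric positive semidefinite, so its eigenvalues are all real and
   nonnegative, and their square roots are the singular values of H (padded
   with zeros when m < n). *)
Definition singular_values (R : realType) (m n : nat) (H : 'M[R]_(m, n)) :
  set R := [set Num.sqrt a | a in [set a : R | eigenvalue (H^T *m H) a]].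

(* The set of singular values is finite; its sup is its maximum if 0 < n, and
   is 0 if n = 0. *)
Definition max_singular_value (R : realType) (m n : nat) (H : 'M[R]_(m, n)) :
  R := sup (singular_values H).

(* The minimizer exists and is unique as soon as S is nonempty, closed and
   convex; proj S x is a dummy value if there is no minimizer. *)
Definition proj (R : realType) (n : nat) (S : set 'cV[R]_n) (x : 'cV[R]_n) :
  'cV[R]_n :=
  get [set p : 'cV[R]_n |
    S p /\ forall y, S y -> enorm (x - p) <= enorm (x - y)].

Definition closed_convex (R : realType) (n : nat) (S : set 'cV[R]_n) : Prop :=
  closed S /\ @convex_set R 'cV[R]_n S.

Definition closed_convex_cone (R : realType) (m : nat) (K : set 'cV[R]_m) :
  Prop :=
  [/\ K !=set0, closed_convex K &
      forall (w : 'cV[R]_m) (gamma : R), K w -> 0 <= gamma -> K (gamma *: w)].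

Definition polar (R : realType) (m : nat) (K : set 'cV[R]_m) : set 'cV[R]_m :=
  [set w | forall y, K y -> dot w y <= 0].

(* The infimum is attained when K is nonempty and closed. *)
Definition qdist (R : realType) (m : nat) (K : set 'cV[R]_m) (w : 'cV[R]_m) :
  R := inf [set 2^-1 * enorm (w - v) ^+ 2 | v in K].

Definition grad (R : realType) (n : nat) (f : 'cV[R]_n -> R) (z : 'cV[R]_n) :
  'cV[R]_n := \col_(i < n) 'D_(delta_mx i 0) f z.

Definition continuously_differentiable (R : realType) (n : nat)
  (f : 'cV[R]_n -> R) : Prop :=
  (forall z, differentiable f z) /\ continuous (grad f).

Definition bregman (R : realType) (n : nat) (f : 'cV[R]_n -> R)
  (z z' : 'cV[R]_n) : R := f z - f z' - dot (grad f z') (z - z').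

Definition lagrangian (R : realType) (m n : nat) (f : 'cV[R]_n -> R)
  (H : 'M[R]_(m, n)) (g : 'cV[R]_m) (z : 'cV[R]_n) (w : 'cV[R]_m) : R :=
  f z + dot (H *m z - g) w.

Definition saddle_point (R : realType) (m n : nat) (f : 'cV[R]_n -> R)
  (D : set 'cV[R]_n) (K : set 'cV[R]_m) (H : 'M[R]_(m, n)) (g : 'cV[R]_m)
  (zs : 'cV[R]_n) (ws : 'cV[R]_m) : Prop :=
  [/\ D zs, polar K ws &
      forall z w, D z -> polar K w ->
        lagrangian f H g zs w <= lagrangian f H g zs ws /\
        lagrangian f H g zs ws <= lagrangian f H g z ws].

Record assumptionA (R : realType) (m n : nat) (mu lambda : R)
  (f : 'cV[R]_n -> R) (D : set 'cV[R]_n) (K : set 'cV[R]_m)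
  (H : 'M[R]_(m, n)) (g : 'cV[R]_m) : Prop := AssumptionA {
  A_constants : 0 <= mu /\ mu <= lambda;
  A_C1 : continuously_differentiable f;
  A_bregman : forall z z' : 'cV[R]_n,
    mu / 2 * enorm (z - z') ^+ 2 <= bregman f z z' /\
    bregman f z z' <= lambda / 2 * enorm (z - z') ^+ 2;
  A_D : closed_convex D;
  A_K : closed_convex_cone K;
  A_saddle : exists zs ws, saddle_point f D K H g zs ws
}.

(* The first k PIPG iterations. Indices start at 1: the iterates constrained are
   z 1, ..., z k.+1, v 1, ..., v k.+1 and w 2, ..., w k.+1; the values at other
   indices are irrelevant. *)
Definition pipg (R : realType) (m n : nat) (f : 'cV[R]_n -> R)
  (D : set 'cV[R]_n) (K : set 'cV[R]_m) (H : 'M[R]_(m, n)) (g : 'cV[R]_m)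
  (alpha beta : nat -> R) (k : nat)
  (z : nat -> 'cV[R]_n) (v w : nat -> 'cV[R]_m) : Prop :=
  forall j : nat, (1 <= j <= k)%N ->
    [/\ w j.+1 = proj (polar K) (v j + beta j *: (H *m z j - g)),
        z j.+1 = proj D (z j - alpha j *: (grad f (z j) + H^T *m w j.+1)) &
        v j.+1 = w j.+1 + beta j *: (H *m (z j.+1 - z j))].

(* Main.v *)
Require Import Defs.
From HB Require Import structures.
From mathcomp Require Import all_boot all_order all_algebra.
From mathcomp Require Import all_classical all_reals all_analysis.
From mathcomp Require Import ring lra.
Set Implicit Arguments.
Unset Strict Implicit.
Unset Printing Implicit Defensive.
Import Order.TTheory GRing.Theory Num.Theory.
Import numFieldNormedType.Exports.
Local Open Scope classical_set_scope.
Local Open Scope ring_scope.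

(* Write V_j(x, y) for |z_j - x|^2 / (2 alpha) + |v_j - y|^2 / (2 beta). The
   variational inequalities of the two projections, the descent lemma for f and
   |||H|||^2 <= sigma give, with the chosen alpha,
     L(z_{j+1}, y) - L(x, w_{j+1}) + |w_{j+1} - v_j|^2 / (2 beta)
       <= V_j(x, y) - V_{j+1}(x, y).
   Telescoping and Jensen's inequality bound the gap. At the saddle point the
   gap is nonnegative, so the squares |w_{j+1} - v_j|^2 are summable. By the
   bipolar theorem the residual r_j = v_j + beta (H z_j - g) - w_{j+1} of the
   projection on the polar cone lies in K, and H z_j - g - r_j / beta is
   (w_{j+1} - v_j) / beta; averaging bounds the distance to K. *)

(** * Bilinearity and positivity of the Euclidean inner product *)

Section DotProduct.
Variables (R : realType) (n : nat).
Implicit Types (x y : 'cV[R]_n) (a : R).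

Lemma dotC x y : dot x y = dot y x.
Proof. by apply: eq_bigr => i _; rewrite mulrC. Qed.

Lemma dotDl x1 x2 y : dot (x1 + x2) y = dot x1 y + dot x2 y.
Proof. by rewrite -big_split; apply: eq_bigr => i _; rewrite !mxE mulrDl. Qed.

Lemma dotZl a x y : dot (a *: x) y = a * dot x y.
Proof. by rewrite mulr_sumr; apply: eq_bigr => i _; rewrite !mxE mulrA. Qed.

Lemma dotDr x y1 y2 : dot x (y1 + y2) = dot x y1 + dot x y2.
Proof. by rewrite dotC dotDl !(dotC _ x). Qed.

Lemma dotZr a x y : dot x (a *: y) = a * dot x y.
Proof. by rewrite dotC dotZl dotC. Qed.

Lemma dotNl x y : dot (- x) y = - dot x y.
Proof. by rewrite -scaleN1r dotZl mulN1r. Qed.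

Lemma dotNr x y : dot x (- y) = - dot x y.
Proof. by rewrite dotC dotNl dotC. Qed.

Lemma dot0l y : dot 0 y = 0.
Proof. by rewrite -(scale0r 0) dotZl mul0r. Qed.

Lemma dot0r x : dot x 0 = 0.
Proof. by rewrite dotC dot0l. Qed.

Definition dotE := (dotDl, dotDr, dotNl, dotNr, dotZl, dotZr).

Lemma dot_sumr (I : Type) (r : seq I) (F : I -> 'cV[R]_n) x :
  dot x (\sum_(i <- r) F i) = \sum_(i <- r) dot x (F i).
Proof. by elim/big_rec2: _ => [|i a b _ <-]; rewrite ?dot0r ?dotDr. Qed.

Lemma dot_ge0 x : 0 <= dot x x.
Proof. by apply: sumr_ge0 => i _; rewrite -expr2 sqr_ge0. Qed.

Lemma dot_eq0 x : (dot x x == 0) = (x == 0).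
Proof.
apply/idP/eqP => [|->]; last by rewrite dot0l.
rewrite psumr_eq0 => [/allP x0|i _]; last by rewrite -expr2 sqr_ge0.
apply/matrixP => i j; rewrite ord1 mxE; apply/eqP.
by have := x0 i (mem_index_enum i); rewrite mulf_eq0 orbb.
Qed.

Lemma enorm_sqr x : enorm x ^+ 2 = dot x x.
Proof. by rewrite sqr_sqrtr ?dot_ge0. Qed.

Lemma le_enorm x y : (enorm x <= enorm y) = (dot x x <= dot y y).
Proof. by rewrite ler_sqrt ?dot_ge0. Qed.

Lemma coord_sqr_le_dot x i : x i 0 ^+ 2 <= dot x x.
Proof.
rewrite /dot (bigD1 i)//= -expr2 lerDl.
by apply: sumr_ge0 => j _; rewrite -expr2 sqr_ge0.
Qed.

End DotProduct.

Lemma dot_mulmxl (R : realType) (m n : nat) (H : 'M[R]_(m, n)) x y :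
  dot (H *m x) y = dot x (H^T *m y).
Proof.
have dotM k (a b : 'cV[R]_k) : dot a b = (a^T *m b) 0 0.
  by rewrite mxE; apply: eq_bigr => i _; rewrite mxE.
by rewrite !dotM trmx_mul mulmxA.
Qed.

(** * Continuity, closed sublevel sets and compactness *)

Lemma continuous_sumr (R : realType) (T : topologicalType) (I : Type)
    (r : seq I) (F : I -> T -> R) :
  (forall i, continuous (F i)) -> continuous (fun x => \sum_(i <- r) F i x).
Proof.
move=> cF; elim: r => [|i r IHr].
  by under eq_fun do rewrite big_nil; move=> x; exact: cvg_cst.
under eq_fun do rewrite big_cons.
by move=> x; apply: (@cvgD R R^o); [exact: cF|exact: IHr].
Qed.

Lemma continuous_dot (R : realType) (T : topologicalType) (n : nat)
    (p q : T -> 'cV[R]_n) :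
  (forall i, continuous (fun x => p x i 0)) ->
  (forall i, continuous (fun x => q x i 0)) ->
  continuous (fun x => dot (p x) (q x)).
Proof.
move=> cp cq; apply: continuous_sumr => i x.
by apply: cvgM; [exact: cp|exact: cq].
Qed.

Lemma continuous_mulmx_coord (R : realType) (m n : nat) (H : 'M[R]_(m, n)) i :
  continuous (fun x : 'cV[R]_n => (H *m x) i 0).
Proof.
under eq_fun do rewrite mxE.
apply: continuous_sumr => j x.
apply: (@continuousM _ _ (cst (H i j)) (fun y : 'cV[R]_n => y j 0)) => //.
  exact: cst_continuous.
exact: coord_continuous.
Qed.

Lemma continuous_trmx (R : realType) (m n : nat) :
  continuous (@trmx R m n).
Proof.
move=> x s /= /(nbhs_ballP x^T)[e e0 es]; apply/nbhs_ballP.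
exists e => //= y [_ xy]; apply: es.
by split=> // i j; rewrite !mxE; exact: xy.
Qed.

Lemma closed_sublevel (R : realType) (T : topologicalType) (h : T -> R) c :
  continuous h -> closed [set x | h x <= c].
Proof.
move=> ch; apply: (preimage_closed (f := h) (D := [set t | t <= c])).
  by move=> x _; exact: ch.
exact: closed_le.
Qed.

(** Heine-Borel for row vectors, carried to columns along the continuous map [trmx]. *)
Lemma cV_compact (R : realType) (n : nat) (S : set 'cV[R]_n) (M : R) :
  closed S -> (forall x, S x -> dot x x <= M) -> compact S.
Proof.
move=> cS SM; rewrite (_ : S = trmx @` (trmx @^-1` S)); last first.
  apply/seteqP; split=> [x Sx|_ [x Sx <-]//].
  by exists x^T; rewrite /= trmxK.
apply: continuous_compact; first exact/continuous_subspaceT/continuous_trmx.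
apply: bounded_closed_compact; last first.
  by apply: preimage_closed => // x _; exact: continuous_trmx.
exists (1 + M); split; first exact: num_real.
move=> b Mb y /SM yM /=; rewrite [leLHS]/Num.Def.normr/= mx_normrE.
(* Since t <= 1 + t^2, a bound on the square bounds the coordinate without a square root. *)
have cM i : `|y 0 i| <= 1 + M.
  have := le_trans (coord_sqr_le_dot y^T i) yM.
  rewrite mxE -(real_normK (num_real _)) => yiM; have := normr_ge0 (y 0 i); nra.
apply/bigmax_leP; split=> [|[i j] _ /=].
  apply: ltW; apply: le_lt_trans Mb; have := dot_ge0 y^T; lra.
by rewrite ord1; apply: ltW; exact: le_lt_trans Mb.
Qed.

(** * First-order conditions for scalar quadratics *)

(** At [t = - b / d] with [d = 1 + |c| > c] the form equals -b^2 (d - c) / d^2. *)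
Lemma quadratic_nonneg_lin0 (R : realType) (b c : R) :
  (forall t, 0 <= t * b + t ^+ 2 * c) -> b = 0.
Proof.
move=> h; set d := 1 + `|c|.
have d0 : 0 < d by rewrite ltr_wpDr.
have cd : c < d by rewrite ltr_pwDl// ler_norm.
have eq : (- b / d * b + (- b / d) ^+ 2 * c) * d ^+ 2 = - (b ^+ 2 * (d - c)).
  by field; rewrite gt_eqF.
have := h (- b / d).
rewrite -(pmulr_lge0 _ (exprn_gt0 2 d0)) eq oppr_ge0 pmulr_lle0 ?subr_gt0//.
by move=> b2; apply/eqP; rewrite -sqrf_eq0 eq_le b2 sqr_ge0.
Qed.

(** If b > 0, then t = 1 gives c >= b, so t = b / (2c) is admissible and yields t b <= t b / 2, a
    contradiction. *)
Lemma quadratic_le_lin_le0 (R : realType) (b c : R) :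
  (forall t, 0 <= t <= 1 -> t * b <= t ^+ 2 * c) -> b <= 0.
Proof.
move=> h; rewrite leNgt; apply/negP => b0.
have cb : b <= c by have := h 1; rewrite ler01 lexx; lra.
have c0 : 0 < c by lra.
pose t := b / (2 * c); have t0 : 0 < t by rewrite divr_gt0//; lra.
have tc : t * c = b / 2 by rewrite /t; field; rewrite gt_eqF.
have t1 : t <= 1 by rewrite /t ler_pdivrMr; lra.
have := h t; rewrite (ltW t0) t1 => /(_ isT).
by rewrite expr2 -mulrA tc; nra.
Qed.

(** * Averages in convex sets and Jensen's inequality *)

Lemma convex_setP (R : realType) (n : nat) (S : set 'cV[R]_n) :
  @convex_set R 'cV[R]_n S -> forall x y t, S x -> S y -> 0 <= t <= 1 ->
  S (x + t *: (y - x)).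
Proof.
move=> cS x y t Sx Sy t01.
have /andP[t0 t1] := t01.
have := cS y x (Itv01 t0 t1); rewrite !inE => /(_ Sy Sx).
congr (S _); rewrite /conv/= /unstable.onem scalerBr scalerBl scale1r.
by rewrite addrCA addrC.
Qed.

Lemma convex_avg (R : realType) (n : nat) (S : set 'cV[R]_n)
    (a : nat -> 'cV[R]_n) (k : nat) :
  @convex_set R 'cV[R]_n S -> (1 <= k)%N ->
  (forall j, (1 <= j <= k)%N -> S (a j)) ->
  S (k%:R^-1 *: \sum_(1 <= j < k.+1) a j).
Proof.
move=> cS; case: k => // k _; elim: k => [|k IHk] aS.
  by rewrite big_nat1 invr1 scale1r; exact: aS.
(* The new average is the old one moved towards the new point by the fraction 1 / (k + 2). *)
have -> : k.+2%:R^-1 *: \sum_(1 <= j < k.+3) a j =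
  k.+1%:R^-1 *: \sum_(1 <= j < k.+2) a j +
  k.+2%:R^-1 *: (a k.+2 - k.+1%:R^-1 *: \sum_(1 <= j < k.+2) a j).
  rewrite big_nat_recr//= scalerBr scalerDr addrA [in RHS]addrAC.
  congr (_ + _); rewrite scalerA -scalerBl; congr (_ *: _).
  by rewrite -(@natr1 _ k.+1); field; rewrite nat1r natr1 !pnatr_eq0.
apply: convex_setP => //.
- by apply: IHk => j /andP[j1 jk]; apply: aS; rewrite j1 leqW.
- by apply: aS; rewrite /= leqnn.
- by rewrite invr_ge0 ler0n/= invf_le1 ?ler1n// ltr0n.
Qed.

(** An affine minorant touching [h] at the average is enough: its linear part sums to zero. This
    form serves both the Lagrangian and the squared norm. *)
Lemma jensen_avg (R : realType) (n : nat) (h : 'cV[R]_n -> R)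
    (a : nat -> 'cV[R]_n) (k : nat) (c : 'cV[R]_n) :
  let b := k%:R^-1 *: \sum_(1 <= j < k.+1) a j in
  (1 <= k)%N ->
  (forall x, h b + dot c (x - b) <= h x) ->
  k%:R * h b <= \sum_(1 <= j < k.+1) h (a j).
Proof.
move=> b k1 hb.
have kb : k%:R *: b = \sum_(1 <= j < k.+1) a j.
  by rewrite scalerA divff ?scale1r// pnatr_eq0 -lt0n.
have -> : k%:R * h b = \sum_(1 <= j < k.+1) (h b + dot c (a j - b)).
  rewrite big_split/= -dot_sumr sumrB -kb.
  rewrite !sumr_const_nat subn1/= scaler_nat subrr dot0r addr0.
  by rewrite mulr_natl.
exact: ler_sum.
Qed.

Lemma dot_avg_le (R : realType) (n : nat) (a : nat -> 'cV[R]_n) (k : nat) :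
  let b := k%:R^-1 *: \sum_(1 <= j < k.+1) a j in
  (1 <= k)%N -> k%:R * dot b b <= \sum_(1 <= j < k.+1) dot (a j) (a j).
Proof.
(* The slope [2 *: b] is the gradient of the squared norm at [b]; the defect is |x - b|^2. *)
move=> b k1; apply: (@jensen_avg _ _ (fun x => dot x x) _ _ (2 *: b)) => // x.
rewrite -/b; have := dot_ge0 (x - b); move: b => b.
by rewrite !dotE (dotC x b); lra.
Qed.

(** * Projection on a closed convex set *)

Lemma projP (R : realType) (n : nat) (S : set 'cV[R]_n) (x : 'cV[R]_n) :
  closed_convex S -> S !=set0 ->
  S (Defs.proj S x) /\ forall y, S y -> dot (x - Defs.proj S x) (y - Defs.proj S x) <= 0.
Proof.
move=> [clS cvS] [s Ss].
have cdist : continuous (fun y : 'cV[R]_n => dot (x - y) (x - y)).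
  have cxy i : continuous (fun y : 'cV[R]_n => (x - y) i 0).
    under eq_fun do rewrite !mxE.
    move=> y.
    apply: (@continuousB _ R^o _ (cst (x i 0)) (fun y : 'cV[R]_n => y i 0)).
      exact: cst_continuous.
    exact: coord_continuous.
  exact: continuous_dot.
(* Points farther from [x] than [s] cannot be closest, so the search may be restricted to a compact
   set. *)
pose T := S `&` [set y | dot (x - y) (x - y) <= dot (x - s) (x - s)].
have cT : compact T.
  apply: (@cV_compact _ _ _ (2 * dot x x + 2 * dot (x - s) (x - s))).
    apply: closedI => //.
    exact: closed_sublevel.
  (* By the parallelogram law, |y|^2 <= 2 |x|^2 + 2 |x - y|^2. *)
  move=> y [_ /= xy]; have := dot_ge0 (x + (x - y)); move: xy.
  by rewrite !dotE !(dotC y) !(dotC s); lra.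
have Ts : T s by split=> //=.
have [p /set_mem [Sp /= ps] pmin] :=
  compact_EVT_min (ex_intro _ s Ts) cT (continuous_subspaceT cdist).
have pP : exists q, [set q | S q /\
    forall y, S y -> enorm (x - q) <= enorm (x - y)] q.
  exists p; split=> // y Sy; rewrite le_enorm.
  have [xy|xy] := leP (dot (x - y) (x - y)) (dot (x - s) (x - s)).
    by apply: pmin; apply/mem_set; split.
  exact: le_trans ps (ltW xy).
have [{}Sp {}pmin] := getPex pP.
rewrite -/(Defs.proj S x) in Sp pmin *; split=> // y Sy.
set q := Defs.proj S x in Sp pmin *.
(* Minimality is tested along the segment from [q] to [y]; the first-order term gives the
   variational inequality. *)
have /quadratic_le_lin_le0 : forall t, 0 <= t <= 1 ->
  t * (2 * dot (x - q) (y - q)) <= t ^+ 2 * dot (y - q) (y - q).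
  move=> t t01; have := pmin _ (convex_setP cvS Sp Sy t01).
  rewrite le_enorm opprD addrA; move: (x - q) (y - q) => a b.
  by rewrite !dotE (dotC b a); lra.
lra.
Qed.

(** * Polar cones and the bipolar theorem *)

Section PolarCone.
Variables (R : realType) (m : nat) (K : set 'cV[R]_m).

Lemma polar_nonempty : polar K !=set0.
Proof. by exists 0 => y _; rewrite dot0l. Qed.

Lemma polarD u v : polar K u -> polar K v -> polar K (u + v).
Proof. by move=> Ku Kv y Ky; rewrite dotDl; have := Ku _ Ky; have := Kv _ Ky; lra. Qed.

Lemma polarZ a u : 0 <= a -> polar K u -> polar K (a *: u).
Proof. by move=> a0 Ku y Ky; rewrite dotZl mulr_ge0_le0// Ku. Qed.

Lemma closed_convex_polar : closed_convex (polar K).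
Proof.
split.
  rewrite (_ : polar K = \bigcap_(y in K) [set u | dot u y <= 0]); last first.
    by apply/seteqP; split=> u Ku.
  apply: closed_bigI => y _.
  apply: closed_sublevel; apply: continuous_dot => i.
    exact: coord_continuous.
  exact: cst_continuous.
move=> u v t; rewrite !inE => Ku Kv.
by apply: polarD; apply: polarZ => //; rewrite subr_ge0.
Qed.

(** The polar cone is stable under addition, so the variational inequality may be tested at the
    projection plus any polar vector. *)
Lemma polar_proj_residual u : polar (polar K) (u - Defs.proj (polar K) u).
Proof.
have [Kp up] := projP u closed_convex_polar polar_nonempty.
by move=> y Ky; have := up _ (polarD Kp Ky); rewrite [_ + y]addrC addrK.
Qed.

(** Let [p] be the projection of [u] on [K]. Testing at 0 and 2p makes [u - p] orthogonal to [p],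
    hence polar to [K]; then |u - p|^2 = <u, u - p> <= 0. *)
Lemma bipolar : closed_convex_cone K -> polar (polar K) `<=` K.
Proof.
move=> [K0 ccK cK] u Ku.
have [Kp up] := projP u ccK K0; set p := Defs.proj K u in Kp up.
have up0 : dot (u - p) p = 0.
  have := up _ (cK _ 2 Kp (ler0n _ _)); have := up _ (cK _ 0 Kp (lexx _)).
  by rewrite scale0r sub0r !dotE; lra.
have Kup : polar K (u - p).
  by move=> y /up; move: up0; rewrite !dotE; lra.
suff /eqP : u - p == 0 by move/subr0_eq ->.
rewrite -dot_eq0 eq_le dot_ge0 andbT.
have := Ku _ Kup; rewrite dotC.
by rewrite [in X in _ -> X]dotDr dotNr up0 subr0.
Qed.

End PolarCone.

(** * The largest singular value as an operator norm *)

(** A maximizer [u] of |H y|^2 on the unit sphere is an eigenvector of [H^T *m H], so the maximum is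
    the square of a singular value. *)
Lemma dot_mulmx_le (R : realType) (m n : nat) (H : 'M[R]_(m, n)) x :
  dot (H *m x) (H *m x) <= max_singular_value H ^+ 2 * dot x x.
Proof.
(* A nonzero [x] makes the unit sphere nonempty; the case n = 0 is settled here. *)
have [->|x0] := eqVneq x 0; first by rewrite mulmx0 !dot0l mulr0.
have [q qE cq] : exists2 q : 'cV[R]_n -> R,
    forall y, q y = dot (H *m y) (H *m y) & continuous q.
  exists (fun y => dot (H *m y) (H *m y)) => //.
  by apply: continuous_dot => i; exact: continuous_mulmx_coord.
rewrite -qE.
have cdot : continuous (fun y : 'cV[R]_n => dot y y).
  by apply: continuous_dot => i; exact: coord_continuous.
pose S := [set y : 'cV[R]_n | dot y y = 1].
have cS : compact S.
  apply: (@cV_compact _ _ _ 1) => [|y ->//].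
  apply: (preimage_closed (f := fun y : 'cV[R]_n => dot y y)
    (D := [set t | t = 1])) => [y _|]; first exact: cdot.
  exact: closed_eq.
have normalize y : y != 0 -> S ((enorm y)^-1 *: y).
  rewrite -dot_eq0 => y0; rewrite /S/= dotZl dotZr mulrA -invfM -expr2.
  by rewrite enorm_sqr mulVf.
have [u /set_mem Su umax] := compact_EVT_max
  (ex_intro _ _ (normalize _ x0)) cS (continuous_subspaceT cq).
have qZ a y : q (a *: y) = a ^+ 2 * q y.
  by rewrite !qE -scalemxAr dotZl dotZr mulrA.
have q_le y : q y <= q u * dot y y.
  have [->|y0] := eqVneq y 0; first by rewrite qE mulmx0 !dot0l mulr0.
  have y_gt0 : 0 < dot y y by rewrite lt0r dot_eq0 y0 dot_ge0.
  have := umax _ (mem_set (normalize _ y0)); rewrite qZ exprVn enorm_sqr mulrC.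
  by rewrite (ler_pdivrMr _ _ y_gt0).
(* The nonnegative form [q u * |y|^2 - q y] vanishes at [u], so its polar form
   vanishes at [u] against every direction: [u] is an eigenvector. *)
have eig : H^T *m H *m u = q u *: u.
  apply/eqP; rewrite eq_sym -subr_eq0 -dot_eq0; apply/eqP.
  move eE : (q u *: u - _) => e.
  have : 2 * dot e e = 0.
    apply: (@quadratic_nonneg_lin0 _ _ (q u * dot e e - q e)) => t.
    have {1}-> : dot e e = q u * dot u e - dot (H^T *m H *m u) e.
      by rewrite -{1}eE dotDl dotNl dotZl.
    have := q_le (u + t *: e).
    have He : dot (H *m u) (H *m e) = dot (H^T *m H *m u) e.
      by rewrite -mulmxA [RHS]dotC -dot_mulmxl dotC.
    rewrite [q (_ + _)]qE mulmxDr -scalemxAr !dotE (dotC (H *m e) (H *m u)) He (dotC e u).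
    by rewrite -!qE Su; lra.
  lra.
have qu0 : 0 <= q u by rewrite qE dot_ge0.
(* This bounds the singular values above, as the supremum requires. [eigenvalue] speaks of row
   eigenvectors, whence the transposes. *)
have eval a : eigenvalue (H^T *m H) a -> a <= q u.
  move=> /eigenvalueP[r rH r0].
  have rT0 : r^T != 0 by rewrite -(inj_eq trmx_inj) trmxK trmx0.
  have := q_le r^T; rewrite qE dot_mulmxl mulmxA.
  have -> : H^T *m H *m r^T = a *: r^T.
    by rewrite -linearZ/= -rH trmx_mul trmx_mul trmxK.
  have r_gt0 : 0 < dot r^T r^T by rewrite lt0r dot_eq0 rT0 dot_ge0.
  by rewrite dotZr (ler_pM2r r_gt0).
have uM : Num.sqrt (q u) <= max_singular_value H.
  apply: ub_le_sup.
    by exists (Num.sqrt (q u)) => _ [a /eval aq <-]; rewrite ler_sqrt.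
  exists (q u) => //; apply/eigenvalueP; exists u^T.
    by rewrite -linearZ/= -eig trmx_mul trmx_mul trmxK.
  apply: contra_eqN Su => /eqP u0.
  by rewrite -[u]trmxK u0 trmx0 dot0l eq_sym oner_eq0.
apply: le_trans (q_le x) _; rewrite ler_wpM2r ?dot_ge0//.
by rewrite -(sqr_sqrtr qu0) ler_sqr// nnegrE ?sqrtr_ge0// (le_trans _ uM)// sqrtr_ge0.
Qed.

(** * One PIPG iteration, averaged Lagrangians and telescoping *)

Section PIPGStep.
Variables (R : realType) (m n : nat) (f : 'cV[R]_n -> R) (D : set 'cV[R]_n)
  (K : set 'cV[R]_m) (H : 'M[R]_(m, n)) (g : 'cV[R]_m)
  (lambda sigma alpha beta : R).
Hypothesis hA : assumptionA 0 lambda f D K H g.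
Hypothesis hbeta : 0 < beta.
Hypothesis hsigma : max_singular_value H ^+ 2 <= sigma.
Hypothesis hpos : 0 < beta * sigma + lambda.
Hypothesis halpha : alpha = 1 / (beta * sigma + lambda).

Let V (z : 'cV[R]_n) (v : 'cV[R]_m) (x : 'cV[R]_n) (y : 'cV[R]_m) : R :=
  1 / (2 * alpha) * enorm (z - x) ^+ 2 + 1 / (2 * beta) * enorm (v - y) ^+ 2.

(** The lower Bregman bound with mu = 0 is convexity of [f]. *)
Lemma gradient_ineq z x : f z + dot (grad f z) (x - z) <= f x.
Proof.
by have [+ _] := A_bregman hA x z; rewrite /bregman !mul0r; lra.
Qed.

(** The upper Bregman bound between [z'] and [z] is added to convexity between [x] and [z]. *)
Lemma descent z z' x :
  f z' - f x <= dot (grad f z) (z' - x) + lambda / 2 * dot (z' - z) (z' - z).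
Proof.
have [_] := A_bregman hA z' z; have := gradient_ineq z x.
rewrite /bregman enorm_sqr (_ : x - z = (z' - z) - (z' - x)).
  by rewrite dotDr dotNr; lra.
by rewrite opprB [RHS]addrC addrA subrK.
Qed.

(** The weight 1 / (2 alpha) = (beta sigma + lambda) / 2 of |z' - z|^2 pays exactly for the
    smoothness error (lambda / 2) and for the extrapolation error |v' - w'|^2 / (2 beta). *)
Lemma pipg_step z v z' v' w' x y :
  w' = Defs.proj (polar K) (v + beta *: (H *m z - g)) ->
  z' = Defs.proj D (z - alpha *: (grad f z + H^T *m w')) ->
  v' = w' + beta *: (H *m (z' - z)) ->
  D x -> polar K y ->
  lagrangian f H g z' y - lagrangian f H g x w' +
    1 / (2 * beta) * dot (w' - v) (w' - v) <= V z v x y - V z' v' x y.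
Proof.
move=> ew ez ev Dx Ky.
have D0 : D !=set0 by exists x.
have [_ /(_ _ Dx)] := projP (z - alpha *: (grad f z + H^T *m w')) (A_D hA) D0.
have [_ /(_ _ Ky)] := projP (v + beta *: (H *m z - g))
  (closed_convex_polar K) (polar_nonempty K).
rewrite -ew -ez => hw hz.
have alpha0 : 0 < alpha by rewrite halpha div1r invr_gt0.
have ialpha : 1 / (2 * alpha) = (beta * sigma + lambda) / 2.
  by rewrite halpha; field; rewrite gt_eqF.
have hz' : dot (grad f z + H^T *m w') (z' - x) <=
    1 / (2 * alpha) * (dot (z - x) (z - x) - dot (z' - x) (z' - x) -
      dot (z' - z) (z' - z)).
  rewrite mulrC mul1r invfM mulrA ler_pdivlMr// ler_pdivlMr//; move: hz.
  move: (grad f z + H^T *m w') => p.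
  rewrite !dotE !(dotC z) !(dotC z') !(dotC x) (dotC p); lra.
have hw' : dot (H *m z' - g) (y - w') <= 1 / (2 * beta) *
    (dot (v - y) (v - y) - dot (v' - y) (v' - y) + dot (v' - w') (v' - w') -
      dot (w' - v) (w' - v)).
  rewrite mulrC mul1r invfM mulrA ler_pdivlMr// ler_pdivlMr//; move: hw.
  (* The extrapolation beta H (z' - z) = v' - w' trades [H *m z] for [H *m z'] and turns w' - v into
     v' - v; 2 <v' - v, y - w'> then expands into the four squares. *)
  have -> : H *m z' = H *m z + H *m (z' - z) by rewrite -mulmxDr addrC subrK.
  rewrite ev; move: (H *m (z' - z)) (H *m z) => a b.
  rewrite !dotE !(dotC v) !(dotC w') !(dotC y); lra.
have hH : dot (v' - w') (v' - w') <=
    beta ^+ 2 * sigma * dot (z' - z) (z' - z).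
  rewrite ev addrAC subrr add0r dotZl dotZr mulrA -!mulrA.
  rewrite ler_pM2l// ler_pM2l//; apply: le_trans (dot_mulmx_le _ _) _.
  by rewrite ler_wpM2r ?dot_ge0.
have hH' : 1 / (2 * beta) * dot (v' - w') (v' - w') <=
    beta * sigma / 2 * dot (z' - z) (z' - z).
  rewrite mul1r mulrC ler_pdivrMr ?mulr_gt0//.
  rewrite (_ : _ * (2 * beta) = beta ^+ 2 * sigma * dot (z' - z) (z' - z)) //.
  by field.
have := descent z z' x.
have -> : lagrangian f H g z' y - lagrangian f H g x w' = f z' - f x +
    dot (H *m z' - g) (y - w') + dot (H^T *m w') (z' - x).
  rewrite /lagrangian (dotC (H^T *m w')) -dot_mulmxl mulmxBr.
  by rewrite !dotE; lra.
rewrite /V !enorm_sqr.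
move: hz'; rewrite dotDl ialpha; lra.
Qed.

(** The Lagrangian is convex in its first argument, with gradient [grad f b + H^T *m y] at the
    average [b]. *)
Lemma lagrangian_avg_le (a : nat -> 'cV[R]_n) k y : (1 <= k)%N ->
  k%:R * lagrangian f H g (k%:R^-1 *: \sum_(1 <= j < k.+1) a j) y <=
  \sum_(1 <= j < k.+1) lagrangian f H g (a j) y.
Proof.
move=> k1; set b := _ *: _.
apply: (@jensen_avg _ _ (fun z => lagrangian f H g z y) _ _
  (grad f b + H^T *m y)) => // x.
have := gradient_ineq b x; rewrite -/b /lagrangian.
rewrite dotDl (dotC (H^T *m y)) -dot_mulmxl mulmxBr; move: (H *m x) (H *m b) => Hx Hb.
by rewrite !dotDl !dotNl; lra.
Qed.

(** Equality holds because the Lagrangian is affine in its second argument. *)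
Lemma lagrangian_avgr (a : nat -> 'cV[R]_m) k x : (1 <= k)%N ->
  k%:R * lagrangian f H g x (k%:R^-1 *: \sum_(1 <= j < k.+1) a j) =
  \sum_(1 <= j < k.+1) lagrangian f H g x (a j).
Proof.
move=> k1; rewrite /lagrangian big_split/= -dot_sumr sumr_const_nat subn1/=.
by rewrite mulrDr mulr_natl dotZr mulrA divff ?mul1r// pnatr_eq0 -lt0n.
Qed.

Variables (k : nat) (z : nat -> 'cV[R]_n) (v w : nat -> 'cV[R]_m).
Hypothesis k1 : (1 <= k)%N.
Hypothesis hpipg : pipg f D K H g (fun=> alpha) (fun=> beta) k z v w.

(** The final [V] is dropped as nonnegative. The squares stay on the left because they control the
    distance to [K]. *)
Lemma pipg_sum x y : D x -> polar K y ->
  \sum_(1 <= j < k.+1) (lagrangian f H g (z j.+1) y -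
    lagrangian f H g x (w j.+1)) +
  1 / (2 * beta) * \sum_(1 <= j < k.+1) dot (w j.+1 - v j) (w j.+1 - v j) <=
  V (z 1%N) (v 1%N) x y.
Proof.
move=> Dx Ky.
have V0 : 0 <= V (z k.+1) (v k.+1) x y.
  have alpha0 : 0 < alpha by rewrite halpha div1r invr_gt0.
  by rewrite addr_ge0// mulr_ge0 ?sqr_ge0// divr_ge0// mulr_ge0// ltW.
apply: (@le_trans _ _ (\sum_(1 <= j < k.+1)
    - (V (z j.+1) (v j.+1) x y - V (z j) (v j) x y))).
  rewrite mulr_sumr -big_split/= big_nat [leRHS]big_nat.
  apply: ler_sum => j /hpipg[ew ez ev]; rewrite opprB.
  exact: pipg_step.
by rewrite sumrN (telescope_sumr (fun j => V (z j) (v j) x y))// opprB gerBl.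
Qed.

End PIPGStep.

Theorem theorem1 (R : realType) (m n : nat) (f : 'cV[R]_n -> R)
  (D : set 'cV[R]_n) (K : set 'cV[R]_m) (H : 'M[R]_(m, n)) (g : 'cV[R]_m)
  (lambda : R) (hA : assumptionA 0 lambda f D K H g)
  (zs : 'cV[R]_n) (ws : 'cV[R]_m) (hs : saddle_point f D K H g zs ws)
  (beta sigma : R) (hbeta : 0 < beta)
  (hsigma : max_singular_value H ^+ 2 <= sigma)
  (hpos : 0 < beta * sigma + lambda)
  (alpha : R) (halpha : alpha = 1 / (beta * sigma + lambda))
  (k : nat) (hk : (1 <= k)%N)
  (z : nat -> 'cV[R]_n) (v w : nat -> 'cV[R]_m)
  (hz1 : D (z 1%N)) (hv1 : polar K (v 1%N))
  (hpipg : pipg f D K H g (fun=> alpha) (fun=> beta) k z v w) :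
  let ztilde : 'cV[R]_n := k%:R^-1 *: \sum_(1 <= j < k.+1) z j in
  let zbar : 'cV[R]_n := k%:R^-1 *: \sum_(1 <= j < k.+1) z j.+1 in
  let wbar : 'cV[R]_m := k%:R^-1 *: \sum_(1 <= j < k.+1) w j.+1 in
  let V1 (x : 'cV[R]_n) (y : 'cV[R]_m) : R :=
    1 / (2 * alpha) * enorm (z 1%N - x) ^+ 2 +
    1 / (2 * beta) * enorm (v 1%N - y) ^+ 2 in
  [/\ D ztilde, D zbar, polar K wbar,
      qdist K (H *m ztilde - g) <= V1 zs ws / (beta * k%:R) &
      forall (x : 'cV[R]_n) (y : 'cV[R]_m), D x -> polar K y ->
        lagrangian f H g zbar y - lagrangian f H g x wbar <= V1 x y / k%:R].
Proof.
move=> ztilde zbar wbar V1.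
have k0 : 0 < k%:R :> R by rewrite ltr0n.
have [clD cvD] := A_D hA.
have D0 : D !=set0 by exists (z 1%N).
have Dz j : (1 <= j <= k)%N -> D (z j.+1).
  by move=> /hpipg[_ -> _]; have [] := projP
    (z j - alpha *: (grad f (z j) + H^T *m w j.+1)) (A_D hA) D0.
have Kw j : (1 <= j <= k)%N -> polar K (w j.+1).
  by move=> /hpipg[-> _ _]; have [] := projP (v j + beta *: (H *m z j - g))
    (closed_convex_polar K) (polar_nonempty K).
have Dzbar : D zbar by exact: (@convex_avg _ _ _ (fun j => z j.+1)).
have Kwbar : polar K wbar.
  by apply: (@convex_avg _ _ _ (fun j => w j.+1)) => //; have [] := closed_convex_polar K.
have Dztilde : D ztilde.
  (* [ztilde] includes the starting point, which is in [D] by hypothesis; later points come from the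
     preceding iteration. *)
  apply: convex_avg => // -[|[|j]]// /andP[_ jk].
  by apply: Dz; rewrite /= ltnW.
have sums := pipg_sum hA hbeta hsigma hpos halpha hpipg.
split=> //.
- have [Dzs Kws sad] := hs.
  pose u j := w j.+1 - v j.
  pose r j := v j + beta *: (H *m z j - g) - w j.+1.
  have Kr j : (1 <= j <= k)%N -> K (r j).
    move=> /hpipg[ew _ _]; apply: (bipolar (A_K hA)).
    by rewrite /r ew; exact: polar_proj_residual.
  have [_ [_ cvK] cK] := A_K hA.
  pose rbar := k%:R^-1 *: \sum_(1 <= j < k.+1) r j.
  pose ubar := k%:R^-1 *: \sum_(1 <= j < k.+1) u j.
  (* The residuals involve [z j], not [z j.+1], so the average that appears is [ztilde]. *)
  have eqr : H *m ztilde - g - beta^-1 *: rbar = beta^-1 *: ubar.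
    have ur j : u j + r j = beta *: (H *m z j - g).
      by rewrite addrC /u /r addrA subrK addrAC subrr add0r.
    apply/eqP; rewrite subr_eq -scalerDr -scalerDr -big_split/=.
    under eq_bigr => j _ do rewrite ur.
    rewrite -scaler_sumr sumrB -mulmx_sumr sumr_const_nat subn1/=.
    rewrite [_ *: (beta *: _)]scalerA [k%:R^-1 * _]mulrC -scalerA scalerK ?gt_eqF//.
    rewrite scalerBr scalemxAr -[g *+ k]scaler_nat [k%:R^-1 *: (_ *: g)]scalerA.
    by rewrite mulVf ?gt_eqF// scale1r.
  (* Each term is split at the saddle value L(zs, ws). *)
  have gap0 : 0 <= \sum_(1 <= j < k.+1) (lagrangian f H g (z j.+1) ws -
      lagrangian f H g zs (w j.+1)).
    rewrite big_nat; apply: sumr_ge0 => j jk.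
    by have [? ?] := sad _ _ (Dz j jk) (Kw j jk); rewrite subr_ge0; lra.
  have usum := dot_avg_le u hk; rewrite -/ubar in usum.
  have := sums _ _ Dzs Kws; rewrite -/(V1 zs ws) => sum_le.
  (* The point [beta^-1 *: rbar] of [K] serves as competitor in the infimum. *)
  apply: (@le_trans _ _ (2^-1 * enorm (H *m ztilde - g - beta^-1 *: rbar) ^+ 2)).
    apply: ge_inf; first by exists 0 => _ [a _ <-]; rewrite mulr_ge0 ?sqr_ge0// invr_ge0.
    exists (beta^-1 *: rbar) => //; apply: cK; last by rewrite invr_ge0 ltW.
    exact: convex_avg.
  rewrite eqr enorm_sqr dotZl dotZr ler_pdivlMr ?mulr_gt0//.
  (* Multiplied by beta k, the bound carries the weight of the squares in [pipg_sum], so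
     [dot_avg_le] concludes. *)
  rewrite (_ : 2^-1 * _ * _ = 1 / (2 * beta) * (k%:R * dot ubar ubar)); last first.
    by field; rewrite gt_eqF.
  apply: le_trans sum_le; apply: le_trans (ler_wpDl gap0 (lexx _)).
  by rewrite ler_wpM2l// divr_ge0// mulr_ge0// ltW.
- move=> x y Dx Ky; rewrite ler_pdivlMr// mulrC mulrBr.
  rewrite lagrangian_avgr//.
  have := lagrangian_avg_le hA (fun j => z j.+1) y hk; rewrite -/zbar.
  have := sums _ _ Dx Ky; rewrite -/(V1 x y) sumrB.
  have : 0 <= 1 / (2 * beta) *
      \sum_(1 <= j < k.+1) dot (w j.+1 - v j) (w j.+1 - v j).
    rewrite mulr_ge0//; first by rewrite divr_ge0// mulr_ge0// ltW.
    by apply: sumr_ge0 => j _; exact: dot_ge0.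
  lra.
Qed.
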